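(* Let $\mathcal{H}_1,\mathcal{H}_2,\ldots,\mathcal{H}_n$ be complex Hilbert spaces. Let $T=(T_{ij})$ be an $n\times n$ operator matrix, where $T_{ij}\in\mathcal{B}(\mathcal{H}_j,\mathcal{H}_i)$. Then (i) $\displaystyle w(T)\le\min_{0\le\alpha\le1}\sqrt{\left\|\alpha|R|^2+(1-\alpha)|S|^2\right\|}\le w(\tilde T)$, (ii) $\displaystyle \|T\|\le\min_{0\le\alpha\le1}\frac{1}{\max\left\{\frac12,\sqrt{1-\alpha}\right\}}\sqrt{\left\|\alpha|R|^2+(1-\alpha)|S|^2\right\|}\le\|S\|$, where $\tilde T=(\tilde t_{ij})_{n\times n}$ with $\tilde t_{ij}=w(T_{ij})$ if $i=j$ and $\tilde t_{ij}=\|T_{ij}\|$ if $i\neq j$; $R=(r_{ij})_{n\times n}$ with $r_{ij}=w(T_{ij})$ if $i=j$ and $r_{ij}=\frac12\left(\|T_{ij}\|+\|T_{ji}\|\right)$ if $i\ne j$; and $S=(s_{ij})_{n\times n}$ with $s_{ij}=\|T_{ij}\|$.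
   Context: $\mathcal{B}(\mathcal{H}_j,\mathcal{H}_i)$ is the space of bounded linear operators from $\mathcal{H}_j$ to $\mathcal{H}_i$, and $\|\cdot\|$ is the usual operator norm. An $n\times n$ operator matrix $T=(T_{ij})$ acts on the Hilbert space direct sum $\oplus_{i=1}^n\mathcal{H}_i$ by $(Tx)_i=\sum_{j}T_{ij}x_j$. For a bounded operator $T$ on a complex Hilbert space $\mathcal{K}$: the numerical radius is $w(T)=\sup\{|\langle Tx,x\rangle|:x\in\mathcal{K},\ \|x\|=1\}$, and $|T|=(T^*T)^{1/2}$. Scalar $n\times n$ matrices (such as $R,S,\tilde T$) are regarded as operators on $\mathbb{C}^n$ with the standard inner product. *)

(* Defs.v *)
From HB Require Import structures.
From mathcomp Require Import all_boot all_order all_algebra.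
From mathcomp Require Import complex.
From mathcomp Require Import boolp classical_sets functions reals.
From mathcomp Require Import topology tvs normedtype.

Set Implicit Arguments.
Unset Strict Implicit.
Unset Printing Implicit Defensive.

Import Order.TTheory GRing.Theory Num.Theory.
Import numFieldNormedType.Exports.

Local Open Scope classical_set_scope.
Local Open Scope ring_scope.

HB.mixin Record NormedModule_isPreHilbert (C : numClosedFieldType) V
    & NormedModule C V := {
  inner : V -> V -> C;
  innerPl : forall (a : C) (x y z : V),
    inner (a *: x + y) z = a * inner x z + inner y z;
  innerC : forall x y : V, inner y x = (inner x y)^*;
  normr_inner : forall x : V, `|x| ^+ 2 = inner x x
}.

#[short(type="preHilbertType")]
HB.structure Definition PreHilbert (C : numClosedFieldType) :=
  {V of NormedModule C V & NormedModule_isPreHilbert C V}.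

#[short(type="hilbertType")]
HB.structure Definition Hilbert (C : numClosedFieldType) :=
  {V of PreHilbert C V & Complete V}.

HB.factory Record Lmodule_isPreHilbert (C : numClosedFieldType) V
    & GRing.Lmodule C V := {
  inner : V -> V -> C;
  innerPl : forall (a : C) (x y z : V),
    inner (a *: x + y) z = a * inner x z + inner y z;
  innerC : forall x y : V, inner y x = (inner x y)^*;
  inner_ge0 : forall x : V, 0 <= inner x x;
  inner_eq0 : forall x : V, inner x x = 0 -> x = 0
}.

HB.builders Context C V & Lmodule_isPreHilbert C V.

Let innerDl x y z : inner (x + y) z = inner x z + inner y z.
Proof. by rewrite -[x in LHS]scale1r innerPl mul1r. Qed.

Let inner0l z : inner 0 z = 0.
Proof. by apply: (addrI (inner 0 z)); rewrite -innerDl !addr0. Qed.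

Let innerZl a x z : inner (a *: x) z = a * inner x z.
Proof. by rewrite -[in LHS](addr0 (a *: x)) innerPl inner0l addr0. Qed.

Let innerDr x y z : inner z (x + y) = inner z x + inner z y.
Proof. by rewrite innerC innerDl rmorphD/= -!innerC. Qed.

Let innerZr a x z : inner z (a *: x) = a^* * inner z x.
Proof. by rewrite innerC innerZl rmorphM/= -innerC. Qed.

Let nrm x := sqrtC (inner x x).

Let nrmZ (a : C) x : nrm (a *: x) = `|a| * nrm x.
Proof.
rewrite /nrm innerZl innerZr mulrA -normCK.
by rewrite rootCMl ?exprn_ge0// sqrCK.
Qed.

Let nrm0_eq0 x : nrm x = 0 -> x = 0.
Proof. by move=> /eqP; rewrite sqrtC_eq0 => /eqP /inner_eq0. Qed.

Let inner_sq_le x y : `|inner x y| ^+ 2 <= inner x x * inner y y.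
Proof.
have [y0|yN0] := eqVneq (inner y y) 0.
  by rewrite (inner_eq0 y0) innerC inner0l conjC0 normr0 expr0n/= inner0l mulr0.
have ypos : 0 < inner y y by rewrite lt_def yN0 inner_ge0.
pose c := - (inner x y / inner y y).
have /= := inner_ge0 (x + c *: y).
rewrite innerDl !innerDr !innerZl !innerZr (innerC x y).
have -> : c * (c^* * inner y y) = - c * (inner x y)^*.
  rewrite {2}/c rmorphN/= rmorphM/= fmorphV/= -(innerC y y).
  by rewrite !mulNr divfK// mulrN.
rewrite [X in _ + (_ + X)]mulNr subrr addr0 /c rmorphN/= rmorphM/= fmorphV/= -(innerC y y).
rewrite mulNr subr_ge0 mulrAC ler_pdivrMr//.
by rewrite mulrC -normCK.
Qed.

Let inner_le x y : `|inner x y| <= nrm x * nrm y.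
Proof.
rewrite -(@ler_pXn2r _ 2)// ?nnegrE ?mulr_ge0 ?sqrtC_ge0 ?inner_ge0//.
by rewrite exprMn !sqrtCK inner_sq_le.
Qed.

Let ler_nrmD x y : nrm (x + y) <= nrm x + nrm y.
Proof.
rewrite -(@ler_pXn2r _ 2)// ?nnegrE ?addr_ge0 ?sqrtC_ge0 ?inner_ge0//.
rewrite sqrrD !sqrtCK innerDl !innerDr -!addrA lerD2l !addrA lerD2r.
have rl : inner x y + inner y x \is Num.real.
  by rewrite CrealE rmorphD/= -!innerC addrC.
apply: (le_trans (real_ler_norm rl)).
apply: (le_trans (ler_normD _ _)).
by rewrite [`|inner y x|](_ : _ = `|inner x y|) ?(innerC x y) ?norm_conjC//
  lerD// inner_le.
Qed.

HB.instance Definition _ :=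
  Lmodule_isNormed.Build C V ler_nrmD nrmZ nrm0_eq0.

Let normr_inner x : `|x| ^+ 2 = inner x x.
Proof. by rewrite /Num.norm/= sqrtCK. Qed.

HB.instance Definition _ :=
  NormedModule_isPreHilbert.Build C V innerPl innerC normr_inner.

HB.end.

(** The field of complex numbers as a Hilbert space over itself.  The type
   [R[i]^o] cannot carry the instance: completeness of [_^o] is already
   declared for [realType]. *)
Definition Cspace (R : realType) : Type := R[i].

Section Cspace.
Variable R : realType.

HB.instance Definition _ := GRing.Lmodule.copy (Cspace R) R[i]^o.

Let innerc (x y : Cspace R) : R[i] := (x : R[i]) * (y : R[i])^*.

Let innercPl (a : R[i]) (x y z : Cspace R) :
  innerc (a *: x + y) z = a * innerc x z + innerc y z.
Proof. by rewrite /innerc mulrDl mulrA. Qed.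

Let innercC (x y : Cspace R) : innerc y x = (innerc x y)^*.
Proof. by rewrite /innerc rmorphM/= conjCK mulrC. Qed.

Let innerc_ge0 (x : Cspace R) : 0 <= innerc x x.
Proof. exact: mul_conjC_ge0. Qed.

Let innerc_eq0 (x : Cspace R) : innerc x x = 0 -> x = 0.
Proof. by move=> /eqP; rewrite mul_conjC_eq0 => /eqP. Qed.

HB.instance Definition _ := Lmodule_isPreHilbert.Build R[i] (Cspace R)
  innercPl innercC innerc_ge0 innerc_eq0.

Let normCE (x : Cspace R) : `|x| = `|x : R[i]|.
Proof.
apply/eqP; rewrite -(@eqrXn2 _ 2)//; apply/eqP.
by rewrite normr_inner normCK.
Qed.

Let norm_ltc (x : R[i]) (e : R) :
  `|x| < e%:C%C -> `|complex.Re x| < e /\ `|complex.Im x| < e.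
Proof.
rewrite normc_def ltcR => xe.
by split; apply: le_lt_trans xe; rewrite -sqrtr_sqr ler_wsqrtr//
  ?lerDl ?lerDr sqr_ge0.
Qed.

Let ltc_norm (x : R[i]) (e : R) :
  `|complex.Re x| < e / 2 -> `|complex.Im x| < e / 2 -> `|x| < e%:C%C.
Proof.
move=> rx ix; rewrite normc_def ltcR.
have ab : `|complex.Re x| + `|complex.Im x| < e by rewrite (splitr e) ltrD.
apply: le_lt_trans ab; rewrite -[leRHS]ger0_norm ?addr_ge0// -sqrtr_sqr.
rewrite ler_wsqrtr// sqrrD !real_normK ?num_real// addrAC lerDl.
by rewrite mulrn_wge0// mulr_ge0.
Qed.

Lemma Cspace_complete (F : set_system (Cspace R)) :
  ProperFilter F -> cauchy F -> cvg F.
Proof.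
move=> FF /cauchy_ballP Fc.
have part (p : Cspace R -> R) :
    (forall (x : Cspace R) (e : R), `|x| < e%:C%C -> `|p x| < e) ->
    {morph p : x y / x - y} -> cvg (p @ F).
  move=> pe pB; apply: cauchy_cvg; apply/cauchy_ballP => e e0.
  have e0' : 0 < e%:C%C :> R[i] by rewrite ltcR.
  have := Fc _ e0'.
  move=> [[A B]] /= [FA FB] AB.
  exists (p @` A, p @` B) => /=.
    by split; [apply: filterS FA|apply: filterS FB] => x Ax; exists x.
  move=> [_ _] /= [[x Ax <-] [y By <-]].
  rewrite -ball_normE /= -pB; apply: pe.
  by have := AB (x, y) (conj Ax By); rewrite -ball_normE.
have cRe : cvg ((fun x : Cspace R => complex.Re x) @ F).
  apply: part => [x e|x y]; last by case: x y => ? ? [].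
  by rewrite normCE => /norm_ltc[].
have cIm : cvg ((fun x : Cspace R => complex.Im x) @ F).
  apply: part => [x e|x y]; last by case: x y => ? ? [].
  by rewrite normCE => /norm_ltc[].
move/cvg_ex: cRe => [a /= Fa]; move/cvg_ex: cIm => [b /= Fb].
apply/cvg_ex; exists (a +i* b : Cspace R)%C.
apply/fcvgrPdist_lt => e e0.
have eE : e = (complex.Re e)%:C%C by rewrite RRe_real// gtr0_real.
have re0 : 0 < complex.Re e by rewrite -ltcR -eE.
rewrite eE.
move/cvgrPdist_lt : Fa => /(_ _ (divr_gt0 re0 (@ltr0Sn R 1))) Fa.
move/cvgrPdist_lt : Fb => /(_ _ (divr_gt0 re0 (@ltr0Sn R 1))) Fb.
near=> x; rewrite normCE; apply: ltc_norm.
  by rewrite raddfB/=; near: x.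
by rewrite raddfB/=; near: x.
Unshelve. all: by end_near. Qed.

HB.instance Definition _ :=
  Uniform_isComplete.Build (Cspace R) Cspace_complete.

Lemma Cspace_innerE (x y : Cspace R) :
  inner x y = (x : R[i]) * (y : R[i])^*.
Proof. by []. Qed.

End Cspace.

Definition hsum (C : numClosedFieldType) (n : nat) (H : 'I_n -> hilbertType C)
  : Type := forall i, H i.

Section hsum.
Variables (C : numClosedFieldType) (n : nat) (H : 'I_n -> hilbertType C).

HB.instance Definition _ := gen_eqMixin (hsum H).
HB.instance Definition _ := gen_choiceMixin (hsum H).

Let hsumP (x y : hsum H) : (forall i, x i = y i) -> x = y.
Proof. exact: functional_extensionality_dep. Qed.

Let addh (x y : hsum H) : hsum H := fun i => x i + y i.
Let opph (x : hsum H) : hsum H := fun i => - x i.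
Let zeroh : hsum H := fun i => 0.

Let addhA : associative addh.
Proof. by move=> x y z; apply: hsumP => i; rewrite /addh addrA. Qed.

Let addhC : commutative addh.
Proof. by move=> x y; apply: hsumP => i; rewrite /addh addrC. Qed.

Let add0h : left_id zeroh addh.
Proof. by move=> x; apply: hsumP => i; rewrite /addh add0r. Qed.

Let addNh : left_inverse zeroh opph addh.
Proof. by move=> x; apply: hsumP => i; rewrite /addh addNr. Qed.

HB.instance Definition _ :=
  GRing.isZmodule.Build (hsum H) addhA addhC add0h addNh.

Let scaleh (a : C) (x : hsum H) : hsum H := fun i => a *: x i.

Let scalehA a b x : scaleh a (scaleh b x) = scaleh (a * b) x.
Proof. by apply: hsumP => i; rewrite /scaleh scalerA. Qed.

Let scale1h : left_id 1 scaleh.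
Proof. by move=> x; apply: hsumP => i; rewrite /scaleh scale1r. Qed.

Let scalehDr : right_distributive scaleh +%R.
Proof. by move=> a x y; apply: hsumP => i; rewrite /scaleh scalerDr. Qed.

Let scalehDl x : {morph scaleh^~ x : a b / a + b}.
Proof. by move=> a b; apply: hsumP => i; rewrite /scaleh scalerDl. Qed.

HB.instance Definition _ := GRing.Zmodule_isLmodule.Build C (hsum H)
  scalehA scale1h scalehDr scalehDl.

Let innerh (x y : hsum H) : C := \sum_i inner (x i) (y i).

Let innerhPl (a : C) (x y z : hsum H) :
  innerh (a *: x + y) z = a * innerh x z + innerh y z.
Proof.
by rewrite /innerh mulr_sumr -big_split/=; apply: eq_bigr => i _; rewrite innerPl.
Qed.

Let innerhC (x y : hsum H) : innerh y x = (innerh x y)^*.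
Proof. by rewrite /innerh rmorph_sum/=; apply: eq_bigr => i _; rewrite innerC. Qed.

Let innerh_ge0 (x : hsum H) : 0 <= innerh x x.
Proof. by apply: sumr_ge0 => i _; rewrite -normr_inner exprn_ge0. Qed.

Let innerh_eq0 (x : hsum H) : innerh x x = 0 -> x = 0.
Proof.
move=> /eqP; rewrite psumr_eq0; last first.
  by move=> i _; rewrite -normr_inner exprn_ge0.
move=> /allP x0; apply: hsumP => i; apply/eqP.
have := x0 i (mem_index_enum i).
by rewrite -normr_inner expf_eq0/= normr_eq0.
Qed.

HB.instance Definition _ := Lmodule_isPreHilbert.Build C (hsum H)
  innerhPl innerhC innerh_ge0 innerh_eq0.

Let normh_sq (x : hsum H) : `|x| ^+ 2 = \sum_i `|x i| ^+ 2.
Proof.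
by rewrite normr_inner; apply: eq_bigr => i _; rewrite normr_inner.
Qed.

Let norm_hsum_le (x : hsum H) i : `|x i| <= `|x|.
Proof.
rewrite -(@ler_pXn2r _ 2)// ?nnegrE// normh_sq (bigD1 i)//= lerDl.
by apply: sumr_ge0 => j _; rewrite exprn_ge0.
Qed.

Let norm_hsum_le_sum (x : hsum H) : `|x| <= \sum_i `|x i|.
Proof.
have s0 (r : seq 'I_n) : 0 <= \sum_(i <- r) `|x i| by exact: sumr_ge0.
rewrite -(@ler_pXn2r _ 2)// ?nnegrE// normh_sq.
elim: (index_enum _) => [|i r IHr]; first by rewrite !big_nil expr0n.
rewrite !big_cons sqrrD addrAC -addrA lerD2l (le_trans IHr)// lerDl.
by rewrite mulrn_wge0// mulr_ge0.
Qed.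

Lemma hsum_complete (F : set_system (hsum H)) :
  ProperFilter F -> cauchy F -> cvg F.
Proof.
move=> FF /cauchy_ballP Fc.
have ci i : cvg ((fun x : hsum H => x i) @ F).
  apply: cauchy_cvg; apply/cauchy_ballP => e e0.
  have [[A B] /= [FA FB] AB] := Fc _ e0.
  exists ((fun x => x i) @` A, (fun x => x i) @` B) => /=.
    by split; [apply: filterS FA|apply: filterS FB] => x Ax; exists x.
  move=> [_ _] /= [[x Ax <-] [y By <-]].
  have := AB (x, y) (conj Ax By); rewrite -!ball_normE /=.
  exact: (le_lt_trans (norm_hsum_le (x - y) i)).
pose l : hsum H := fun i => lim ((fun x : hsum H => x i) @ F).
apply/cvg_ex; exists l; apply/fcvgrPdist_lt => e e0.
have en0 : 0 < e / n.+1%:R by rewrite divr_gt0.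
have Fl : \forall x \near F, forall i, `|l i - x i| < e / n.+1%:R.
  apply: filter_forall => i.
  by have /cvgrPdist_lt := ci i; apply.
near=> x; apply: (le_lt_trans (norm_hsum_le_sum (l - x))).
apply: (@le_lt_trans _ _ (\sum_(i < n) e / n.+1%:R)).
  by apply: ler_sum => i _; apply: ltW; move: i; near: x.
rewrite sumr_const card_ord -[_ *+ _]mulr_natr -mulrA gtr_pMr//.
by rewrite mulrC ltr_pdivrMr// mul1r ltr_nat.
Unshelve. all: by end_near. Qed.

HB.instance Definition _ := Uniform_isComplete.Build (hsum H) hsum_complete.

Lemma hsum_innerE (x y : hsum H) : inner x y = \sum_i inner (x i) (y i).
Proof. by []. Qed.

End hsum.

Section operators.
Variable R : realType.
Implicit Types V W : hilbertType R[i].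

Definition bounded_op V W (f : V -> W) : Prop :=
  linear f /\ exists M : R, forall x, `|f x| <= M%:C%C * `|x|.

(* The norm of a space over [R[i]] is [R[i]]-valued, hence [complex.Re]. *)
Definition opnorm V W (f : V -> W) : R :=
  sup [set complex.Re `|f x| | x in [set x | `|x| <= 1]].

(* On the zero space this is [sup set0 = 0]. *)
Definition numradius V (f : V -> V) : R :=
  sup [set complex.Re `|inner (f x) x| | x in [set x | `|x| = 1]].

(* For bounded [f], Riesz representation makes the set below a singleton, and
   so is the set in [sqrt_op] when [f] is positive: the default value [0] of
   [xget] is only used outside these cases. *)
Definition adjoint V W (f : V -> W) : W -> V :=
  xget 0 [set g | forall x y, inner (f x) y = inner x (g y)].

(* [0 <= z] in [R[i]] includes that [z] is real. *)
Definition positive_op V (f : V -> V) : Prop :=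
  bounded_op f /\ forall x, 0 <= inner (f x) x.

Definition sqrt_op V (f : V -> V) : V -> V :=
  xget 0 [set g | positive_op g /\ g \o g = f].

Definition abs_op V W (f : V -> W) : V -> V := sqrt_op (adjoint f \o f).

Definition opmx n (H : 'I_n -> hilbertType R[i])
    (T : forall i j, H j -> H i) : hsum H -> hsum H :=
  fun x i => \sum_j T i j (x j).

Definition Cn n : hilbertType R[i] := hsum (fun _ : 'I_n => Cspace R).

Definition scalar_op n (A : 'M[R]_n) : Cn n -> Cn n :=
  @opmx n (fun=> Cspace R) (fun i j z => (A i j)%:C%C *: z).

Definition tilde_mx n (H : 'I_n -> hilbertType R[i])
    (T : forall i j, H j -> H i) : 'M[R]_n :=
  \matrix_(i, j) if i == j then numradius (T i i) else opnorm (T i j).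

Definition R_mx n (H : 'I_n -> hilbertType R[i])
    (T : forall i j, H j -> H i) : 'M[R]_n :=
  \matrix_(i, j) if i == j then numradius (T i i)
                 else (opnorm (T i j) + opnorm (T j i)) / 2.

Definition S_mx n (H : 'I_n -> hilbertType R[i])
    (T : forall i j, H j -> H i) : 'M[R]_n :=
  \matrix_(i, j) opnorm (T i j).

Definition combination_op V (f g : V -> V) (alpha : R) : V -> V :=
  alpha%:C%C *: (abs_op f \o abs_op f)
  + (1 - alpha)%:C%C *: (abs_op g \o abs_op g).

Definition is_min (A : set R) (m : R) : Prop := A m /\ lbound A m.

End operators.

(* Main.v *)
Require Import Defs.
From mathcomp Require Import all_boot all_order all_algebra.
From mathcomp Require Import complex.
From mathcomp Require Import boolp classical_sets functions reals.
From mathcomp Require Import topology tvs normedtype.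
From mathcomp Require Import spectral derive realfun ring lra.
Set Implicit Arguments.
Unset Strict Implicit.
Unset Printing Implicit Defensive.
Import Order.TTheory GRing.Theory Num.Theory.
Import numFieldNormedType.Exports.
Local Open Scope classical_set_scope.
Local Open Scope ring_scope.

(** For a vector [x] of the direct sum let [v = norms x] be the vector of
C^n with entries [`|x i|], which has the norm of [x].  Both halves come from
comparing [T] with nonnegative matrices acting on [v].

Bounding every block of [<T x, x>] separately, diagonal blocks by their
numerical radius and the others by their norm, gives
[|<T x, x>| <= <T~ v, v>] (lemma [inner_opmx_le]).  A quadratic form at a real
vector depends only on the symmetric part of its matrix, and [R] is the
symmetric part of [T~]; hence [<T~ v, v> = <R v, v> <= ||R v|| ||v||].  As
[T~] is entrywise at most [S], also [<T~ v, v> <= ||S v|| ||v||].  The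
weighted mean of the squares of these two estimates is

  [|<T x, x>|^2 <= (a ||R v||^2 + (1 - a) ||S v||^2) ||v||^2
                 = <(a |R|^2 + (1 - a) |S|^2) v, v> ||v||^2],

which by Cauchy-Schwarz is the lower bound of (i) for every [a].  The upper bound is the value
at [a = 1]: [R] is self-adjoint, so [||R|| = w(R)] by polarization
([opnorm_le_numradius]), and [|<R z, z>| <= <R |z|, |z|> = <T~ |z|, |z|>] for
every complex [z].

For (ii), the general inequality [||T|| <= 2 w(T)] and (i) give the bound with
the factor [1/2], while [||T x|| <= ||S v||] ([rnorm_opmx_le]) and
[(1 - a) |S|^2 <= a |R|^2 + (1 - a) |S|^2] give the one with [sqrt (1 - a)];
the value at [a = 0] is [||S||].

The infima are attained because [a |R|^2 + (1 - a) |S|^2] is affine in [a], so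
that its norm is a Lipschitz function of [a].

The operator [|A|] is a chosen positive square root of [A^* A], and only its
square enters the argument; [abs_op_sq] computes it as [A^T A], for which some
positive square root must exist: the spectral theorem provides one
([mxop_sqrt]). *)

(** * Real-valued norms and inner products *)

(** Norms over [R[i]] are themselves complex numbers; their real parts live in
an ordered field, where linear arithmetic is available. *)
Definition rnorm (R : realType) (V : normedZmodType R[i]) (x : V) : R :=
  complex.Re `|x|.

Lemma rnormE (R : realType) (V : normedZmodType R[i]) (x : V) :
  `|x| = (rnorm x)%:C%C.
Proof. by rewrite /rnorm RRe_real ?normr_real. Qed.

Lemma rnorm_ge0 (R : realType) (V : normedZmodType R[i]) (x : V) : 0 <= rnorm x.
Proof. by rewrite -lecR -rnormE; exact: normr_ge0. Qed.

Lemma rnorm_eq0 (R : realType) (V : normedZmodType R[i]) (x : V) :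
  (rnorm x == 0) = (x == 0).
Proof. by rewrite -(inj_eq (@complexI R)) -rnormE normr_eq0. Qed.

Lemma rnorm0 (R : realType) (V : normedZmodType R[i]) : rnorm (0 : V) = 0.
Proof. by apply/eqP; rewrite rnorm_eq0. Qed.

Lemma rnormN (R : realType) (V : normedZmodType R[i]) (x : V) : rnorm (- x) = rnorm x.
Proof. by rewrite /rnorm normrN. Qed.

Lemma ler_rnormD (R : realType) (V : normedZmodType R[i]) (x y : V) :
  rnorm (x + y) <= rnorm x + rnorm y.
Proof. by rewrite -lecR rmorphD/= -!rnormE ler_normD. Qed.

Lemma ler_rnorm_sum (R : realType) (V : normedZmodType R[i]) (I : finType)
  (F : I -> V) : rnorm (\sum_i F i) <= \sum_i rnorm (F i).
Proof.
elim/big_ind2 : _ => [|a x b y ax by_|//]; first by rewrite rnorm0.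
exact: le_trans (ler_rnormD _ _) (lerD ax by_).
Qed.

Lemma rnorm_real (R : realType) (a : R) : rnorm (a%:C%C : R[i]) = `|a|.
Proof. by rewrite /rnorm normc_def /= expr0n addr0 sqrtr_sqr. Qed.

Lemma rnormM (R : realType) (a b : R[i]) : rnorm (a * b) = rnorm a * rnorm b.
Proof. by apply: (@complexI R); rewrite rmorphM/= -!rnormE normrM. Qed.

Lemma rnormZ (R : realType) (V : hilbertType R[i]) (a : R[i]) (x : V) :
  rnorm (a *: x) = rnorm a * rnorm x.
Proof. by apply: (@complexI R); rewrite rmorphM/= -!rnormE normrZ. Qed.

Lemma conj_real (R : realType) (a : R) : (a%:C%C : R[i])^* = a%:C%C.
Proof. by apply: conj_Creal; apply/complex_realP; exists a. Qed.

Lemma rnorm_i (R : realType) : rnorm ('i : R[i]) = 1.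
Proof. by apply: (@complexI R); rewrite -rnormE normCi. Qed.

Section inner_product.
Variables (R : realType) (V : hilbertType R[i]).
Implicit Types x y z : V.

Lemma innerDl x y z : inner (x + y) z = inner x z + inner y z.
Proof. by rewrite -{1}(scale1r x) innerPl mul1r. Qed.

Lemma inner0l z : inner 0 z = 0.
Proof. by apply: (addrI (inner 0 z)); rewrite -innerDl !addr0. Qed.

Lemma innerZl (a : R[i]) x z : inner (a *: x) z = a * inner x z.
Proof. by rewrite -(addr0 (a *: x)) innerPl inner0l addr0. Qed.

Lemma innerNl x z : inner (- x) z = - inner x z.
Proof. by rewrite -scaleN1r innerZl mulN1r. Qed.

Lemma innerDr x y z : inner z (x + y) = inner z x + inner z y.
Proof. by rewrite innerC innerDl rmorphD/= -!innerC. Qed.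

Lemma innerZr (a : R[i]) x z : inner z (a *: x) = a^* * inner z x.
Proof. by rewrite innerC innerZl rmorphM/= -innerC. Qed.

Lemma innerNr x z : inner z (- x) = - inner z x.
Proof. by rewrite -scaleN1r innerZr rmorphN rmorph1 mulN1r. Qed.

Lemma inner_rnorm x : inner x x = (rnorm x ^+ 2)%:C%C.
Proof. by rewrite -normr_inner rnormE rmorphXn. Qed.

Lemma inner_eq x y : (forall z, inner z x = inner z y) -> x = y.
Proof.
move=> xy; apply/eqP; rewrite -subr_eq0 -rnorm_eq0 -sqrf_eq0.
rewrite -(inj_eq (@complexI R)) -inner_rnorm.
by rewrite innerDr innerNr xy subrr.
Qed.

(** Expanding [||b x - c y||^2 >= 0] for [b = ||y||^2] and [c = <x, y>] leaves
[||y||^2 (||x||^2 ||y||^2 - |c|^2)]. *)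
Lemma cauchy_schwarz x y : rnorm (inner x y) <= rnorm x * rnorm y.
Proof.
have [->|y0] := eqVneq y 0.
  by rewrite innerC inner0l conjC0 !rnorm0 mulr0.
have ny : 0 < rnorm y by rewrite lt_def rnorm_ge0 rnorm_eq0 y0.
pose b : R[i] := (rnorm y ^+ 2)%:C%C; pose c := inner x y.
have : inner (b *: x - c *: y) (b *: x - c *: y) =
    (rnorm y ^+ 2 * (rnorm x ^+ 2 * rnorm y ^+ 2 - rnorm c ^+ 2))%:C%C.
  rewrite !(innerDl, innerDr, innerNl, innerNr, innerZl, innerZr).
  rewrite !inner_rnorm (innerC x y) -/c -/b conj_real -/b.
  have -> : (rnorm y ^+ 2 * (rnorm x ^+ 2 * rnorm y ^+ 2 - rnorm c ^+ 2))%:C%C =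
      b * ((rnorm x ^+ 2)%:C%C * b - c * c^*).
    by rewrite -normCK rnormE /b !(rmorphM, rmorphB, rmorphXn).
  ring.
rewrite inner_rnorm => /(@complexI R) E.
have := sqr_ge0 (rnorm (b *: x - c *: y)).
rewrite E pmulr_rge0 ?exprn_gt0// subr_ge0 -exprMn.
by rewrite ler_pXn2r ?nnegrE ?mulr_ge0 ?rnorm_ge0.
Qed.
End inner_product.

(** * Operator norm and numerical radius *)

Section bounds.
Variable R : realType.
Implicit Types V W : hilbertType R[i].

Lemma linear_fun0 V W (f : V -> W) : linear f -> f 0 = 0.
Proof. by move=> lf; have := lf (-1) 0 0; rewrite !scaleN1r !addNr. Qed.

Lemma linear_funZ V W (f : V -> W) : linear f -> forall a x, f (a *: x) = a *: f x.
Proof. by move=> lf a x; have := lf a x 0; rewrite (linear_fun0 lf) !addr0. Qed.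

Lemma linear_funD V W (f : V -> W) : linear f -> forall x y, f (x + y) = f x + f y.
Proof. by move=> lf x y; have := lf 1 x y; rewrite !scale1r. Qed.

Lemma linear_funN V W (f : V -> W) : linear f -> forall x, f (- x) = - f x.
Proof. by move=> lf x; rewrite -scaleN1r (linear_funZ lf) scaleN1r. Qed.

Lemma bounded_opP V W (f : V -> W) : bounded_op f ->
  linear f /\ exists2 M : R, 0 <= M & forall x, rnorm (f x) <= M * rnorm x.
Proof.
move=> [lf [M Mf]]; split=> //; exists `|M| => // x.
apply: (@le_trans _ _ (M * rnorm x)).
  by rewrite -lecR rmorphM/= -!rnormE Mf.
by rewrite ler_wpM2r ?rnorm_ge0// ler_norm.
Qed.

Lemma bounded_op_rnorm V W (f : V -> W) (M : R) : linear f ->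
  (forall x, rnorm (f x) <= M * rnorm x) -> bounded_op f.
Proof.
by move=> lf Mf; split=> //; exists M => x; rewrite !rnormE -rmorphM/= lecR Mf.
Qed.

Lemma rnorm_unit V (x : V) : x != 0 ->
  exists2 u : V, rnorm u = 1 & x = (rnorm x)%:C%C *: u.
Proof.
move=> x0; have nx : rnorm x != 0 by rewrite rnorm_eq0.
exists ((rnorm x)^-1%:C%C *: x).
  by rewrite rnormZ rnorm_real ger0_norm ?invr_ge0 ?rnorm_ge0// mulVf.
by rewrite scalerA -rmorphM/= mulfV// scale1r.
Qed.

Lemma le_opnorm V W (f : V -> W) : bounded_op f ->
  forall x, rnorm (f x) <= opnorm f * rnorm x.
Proof.
move=> /bounded_opP[lf [M M0 Mf]] x.
have [->|x0] := eqVneq x 0; first by rewrite (linear_fun0 lf) !rnorm0 mulr0.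
have [u u1 ->] := rnorm_unit x0.
rewrite (linear_funZ lf) !rnormZ u1 mulr1 mulrC ler_wpM2r ?rnorm_ge0//.
apply: ub_le_sup; last by exists u => //=; rewrite rnormE u1.
exists M => _ [y /= y1 <-]; apply: le_trans (Mf y) _.
by rewrite ler_piMr// -lecR -rnormE.
Qed.

Lemma opnorm_le V W (f : V -> W) (M : R) : 0 <= M ->
  (forall x, rnorm (f x) <= M * rnorm x) -> opnorm f <= M.
Proof.
move=> M0 Mf; apply: ge_sup.
  by exists (rnorm (f 0)), 0 => //=; rewrite normr0 ler01.
move=> _ [y /= y1 <-]; apply: le_trans (Mf y) _.
by rewrite ler_piMr// -lecR -rnormE.
Qed.

Lemma sup_nonneg (A : set R) : (forall a, A a -> 0 <= a) -> 0 <= sup A.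
Proof.
move=> A0; have [sA|/sup_out ->//] := pselect (has_sup A).
by have [[a Aa] _] := sA; apply: le_trans (A0 _ Aa) _; exact: sup_upper_bound.
Qed.

Lemma opnorm_ge0 V W (f : V -> W) : 0 <= opnorm f.
Proof. by apply: sup_nonneg => _ [y _ <-]; apply: rnorm_ge0. Qed.

Lemma le_numradius V (f : V -> V) : bounded_op f ->
  forall x, rnorm (inner (f x) x) <= numradius f * rnorm x ^+ 2.
Proof.
move=> /bounded_opP[lf [M M0 Mf]] x.
have [->|x0] := eqVneq x 0; first by rewrite (linear_fun0 lf) inner0l !rnorm0 expr0n mulr0.
have [u u1 ->] := rnorm_unit x0.
rewrite (linear_funZ lf) innerZl innerZr conj_real !rnormM rnormZ u1 mulr1 mulrA -expr2.
rewrite mulrC !rnorm_real ger0_norm ?rnorm_ge0// ler_wpM2r ?exprn_ge0 ?rnorm_ge0//.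
apply: ub_le_sup; last by exists u => //=; rewrite rnormE u1.
exists M => _ [y /= y1 <-]; apply: le_trans (cauchy_schwarz _ _) _.
have {}y1 : rnorm y = 1 by apply: (@complexI R); rewrite -rnormE.
by rewrite y1 mulr1 (le_trans (Mf _))// y1 mulr1.
Qed.

Lemma numradius_le V (f : V -> V) (M : R) : 0 <= M ->
  (forall x, rnorm (inner (f x) x) <= M * rnorm x ^+ 2) -> numradius f <= M.
Proof.
move=> M0 Mf; rewrite /numradius; set A := (X in sup X).
have [->|/set0P A0] := eqVneq A set0; first by rewrite sup0.
apply: ge_sup => // _ [y /= y1 <-]; apply: le_trans (Mf y) _.
have {}y1 : rnorm y = 1 by apply: (@complexI R); rewrite -rnormE.
by rewrite y1 expr1n mulr1.
Qed.

Lemma numradius_ge0 V (f : V -> V) : 0 <= numradius f.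
Proof. by apply: sup_nonneg => _ [y _ <-]; exact: (rnorm_ge0 (inner (f y) y)). Qed.

Lemma numradius_le_opnorm V (f : V -> V) : bounded_op f ->
  numradius f <= opnorm f.
Proof.
move=> bf; apply: numradius_le (opnorm_ge0 _) _ => x.
apply: le_trans (cauchy_schwarz _ _) _.
by rewrite expr2 mulrA ler_wpM2r ?rnorm_ge0// le_opnorm.
Qed.

Lemma parallelogram V (x y : V) :
  rnorm (x + y) ^+ 2 + rnorm (x - y) ^+ 2 = 2 * (rnorm x ^+ 2 + rnorm y ^+ 2).
Proof.
apply: (@complexI R); rewrite [RHS]rmorphM !rmorphD /= -!inner_rnorm.
rewrite !(innerDl, innerDr, innerNl, innerNr) rmorph1; ring.
Qed.

(** The parallelogram law for the form [<f z, z>]: the symmetrized form at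
[(x, y)] is half the difference of its values at [x + y] and [x - y], which
are at most [w(f) ||x +- y||^2] in modulus. *)
Lemma polarization_le V (f : V -> V) : bounded_op f -> forall x y,
  rnorm (inner (f x) y + inner (f y) x) <= numradius f * (rnorm x ^+ 2 + rnorm y ^+ 2).
Proof.
move=> bf x y; have [lf _] := bf.
have -> : inner (f x) y + inner (f y) x =
    2^-1 * (inner (f (x + y)) (x + y) - inner (f (x - y)) (x - y)).
  rewrite !(linear_funD lf) (linear_funN lf) !(innerDl, innerDr, innerNl, innerNr).
  by field.
have h : rnorm (2^-1 : R[i]) = 2^-1.
  have -> : 2^-1 = (2^-1 : R)%:C%C :> R[i] by rewrite fmorphV rmorph_nat.
  by rewrite rnorm_real ger0_norm// invr_ge0.
rewrite rnormM h.
have := ler_rnormD (inner (f (x + y)) (x + y)) (- inner (f (x - y)) (x - y)).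
rewrite rnormN.
have := le_numradius bf (x + y); have := le_numradius bf (x - y).
have := congr1 ( *%R (numradius f)) (parallelogram x y); lra.
Qed.

(** Applying [polarization_le] to [y] and to [i y] isolates the term linear in
[x], at the cost of a factor two. *)
Lemma inner_le_numradius V (f : V -> V) : bounded_op f -> forall x y,
  rnorm (inner (f x) y) <= numradius f * (rnorm x ^+ 2 + rnorm y ^+ 2).
Proof.
move=> bf x y; have [lf _] := bf.
have := polarization_le bf x y.
have := polarization_le bf x ('i *: y).
rewrite (linear_funZ lf) innerZl innerZr rnormZ rnorm_i mul1r conjCi => h1 h2.
have := ler_rnormD (inner (f x) y + inner (f y) x)
  ('i * (- 'i * inner (f x) y + 'i * inner (f y) x)).
rewrite [rnorm ('i * _)]rnormM rnorm_i mul1r.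
have -> : inner (f x) y + inner (f y) x +
    'i * (- 'i * inner (f x) y + 'i * inner (f y) x) =
    2%:C%C * inner (f x) y.
  rewrite mulrDr !mulrA mulrN -expr2 sqrCi opprK rmorph_nat; ring.
rewrite rnormM rnorm_real ger0_norm//; lra.
Qed.

(** Polarization bounds are quadratic in [x] and [y]; with [y = t f x] they
take the form assumed here, and [t = ||x|| / ||f x||] is the optimal choice. *)
Lemma opnorm_le_polarized V (f : V -> V) (c : R) : linear f -> 0 <= c ->
  (forall x (t : R), 2 * t * rnorm (f x) ^+ 2 <=
     c * (rnorm x ^+ 2 + t ^+ 2 * rnorm (f x) ^+ 2)) ->
  opnorm f <= c.
Proof.
move=> lf c0 cf; apply: opnorm_le => // x.
have [fx0|fx0] := eqVneq (rnorm (f x)) 0; first by rewrite fx0 mulr_ge0 ?rnorm_ge0.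
have [x0|x0] := eqVneq (rnorm x) 0.
  move: x0 fx0 => /eqP; rewrite rnorm_eq0 => /eqP ->.
  by rewrite (linear_fun0 lf) rnorm0 eqxx.
have := cf x (rnorm x / rnorm (f x)).
rewrite expr_div_n divfK ?expf_neq0//.
have -> : 2 * (rnorm x / rnorm (f x)) * rnorm (f x) ^+ 2 = 2 * (rnorm x * rnorm (f x)) by field.
have -> : c * (rnorm x ^+ 2 + rnorm x ^+ 2) = 2 * (rnorm x * (c * rnorm x)) by ring.
by rewrite ler_pM2l// ler_pM2l// lt_def x0 rnorm_ge0.
Qed.

Lemma opnorm_le_2numradius V (f : V -> V) : bounded_op f ->
  opnorm f <= 2 * numradius f.
Proof.
move=> bf; have [lf _] := bf.
apply: opnorm_le_polarized => // [|x t]; first by rewrite mulr_ge0 ?numradius_ge0.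
have := inner_le_numradius bf x (t%:C%C *: f x).
rewrite innerZr conj_real inner_rnorm -rmorphM/= rnorm_real rnormZ rnorm_real exprMn.
rewrite real_normK ?num_real//.
have := ler_norm (t * rnorm (f x) ^+ 2); lra.
Qed.

(** For self-adjoint [f] and [y = t f x] the two terms of the symmetrized form
coincide, so the factor two of [opnorm_le_2numradius] disappears. *)
Lemma opnorm_le_numradius V (f : V -> V) : bounded_op f ->
  (forall x y, inner (f x) y = inner x (f y)) -> opnorm f <= numradius f.
Proof.
move=> bf sf; have [lf _] := bf.
apply: opnorm_le_polarized => // [|x t]; first exact: numradius_ge0.
have := polarization_le bf x (t%:C%C *: f x).
rewrite (linear_funZ lf) innerZl innerZr conj_real (sf (f x) x) inner_rnorm -!rmorphM/= -!rmorphD/=.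
rewrite rnorm_real rnormZ rnorm_real exprMn real_normK ?num_real//.
have := ler_norm (t * rnorm (f x) ^+ 2 + t * rnorm (f x) ^+ 2); lra.
Qed.

End bounds.

(** * Adjoint and square root *)

Section adjoint_sqrt.
Variable R : realType.
Implicit Types V W : hilbertType R[i].

(** The inner product separates points, so there is at most one such [g]. *)
Lemma adjointP V W (f : V -> W) (g : W -> V) :
  (forall x y, inner (f x) y = inner x (g y)) -> adjoint f = g.
Proof.
move=> fg; rewrite /adjoint; set A := (X in xget _ X).
have Ag : A g by [].
have Aa : A (xget 0 A) := xgetPex 0 (ex_intro _ g Ag).
by apply/funext => y; apply: inner_eq => x; rewrite -fg Aa.
Qed.

(** Existence of one positive root makes the chosen one satisfy its defining
equation. *)
Lemma sqrt_opK V (f g : V -> V) : positive_op g -> g \o g = f ->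
  sqrt_op f \o sqrt_op f = f.
Proof.
move=> pg gf; rewrite /sqrt_op; set A := (X in xget _ X).
have Ag : A g by [].
by have [] : A (xget 0 A) := xgetPex 0 (ex_intro _ g Ag).
Qed.
End adjoint_sqrt.

(** * Operator matrices *)

Section opmx.
Variables (R : realType) (n : nat) (H : 'I_n -> hilbertType R[i]).
Implicit Types (x y : hsum H) (T : forall i j : 'I_n, H j -> H i).

Lemma rnorm_hsum x : rnorm x ^+ 2 = \sum_i rnorm (x i) ^+ 2.
Proof.
apply: (@complexI R); rewrite -inner_rnorm hsum_innerE rmorph_sum/=.
by apply: eq_bigr => i _; rewrite inner_rnorm.
Qed.

Lemma rnorm_coord x i : rnorm (x i) <= rnorm x.
Proof.
rewrite -(@ler_pXn2r _ 2)// ?nnegrE ?rnorm_ge0// rnorm_hsum (bigD1 i)//= lerDl.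
by apply: sumr_ge0 => j _; rewrite exprn_ge0 ?rnorm_ge0.
Qed.

(** As [`|x i| <= `|x|], the sum of the squares is at most [`|x|] times the sum;
[`|x|] then cancels. *)
Lemma rnorm_hsum_le_sum x : rnorm x <= \sum_i rnorm (x i).
Proof.
have [->|x0] := eqVneq (rnorm x) 0.
  by apply: sumr_ge0 => i _; apply: rnorm_ge0.
have xp : 0 < rnorm x by rewrite lt_def x0 rnorm_ge0.
rewrite -(ler_pM2r xp) -expr2 rnorm_hsum mulr_suml; apply: ler_sum => i _.
by rewrite expr2 ler_wpM2l ?rnorm_ge0// rnorm_coord.
Qed.

Lemma opmx_linear T : (forall i j, linear (T i j)) -> linear (opmx T).
Proof.
move=> lT a x y; apply: functional_extensionality_dep => i.
rewrite /opmx -[RHS]/(a *: (\sum_j T i j (x j)) + \sum_j T i j (y j)).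
by rewrite scaler_sumr -big_split; apply: eq_bigr => j _; exact: lT.
Qed.

Lemma opmx_bounded T : (forall i j, bounded_op (T i j)) -> bounded_op (opmx T).
Proof.
move=> bT; apply: (@bounded_op_rnorm _ _ _ _ (\sum_i \sum_j opnorm (T i j))).
  by apply: opmx_linear => i j; have [] := bT i j.
move=> x; apply: le_trans (rnorm_hsum_le_sum _) _.
rewrite mulr_suml; apply: ler_sum => i _.
apply: le_trans (ler_rnorm_sum _) _.
rewrite mulr_suml; apply: ler_sum => j _.
apply: le_trans (le_opnorm (bT i j) _) _.
by rewrite ler_wpM2l ?opnorm_ge0// rnorm_coord.
Qed.

End opmx.

(** * Complex matrices as operators on C^n *)

Section mxop.
Variables (R : realType) (n : nat).
Implicit Types (A B : 'M[R[i]]_n) (x y z : Cn R n) (M N : 'M[R]_n).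

(** Square roots obtained by diagonalization have complex entries, hence complex
matrices here, although [scalar_op] only takes real ones. *)
Definition mxop A : Cn R n -> Cn R n :=
  fun x i => \sum_j A i j * (x j : R[i]).

Lemma mxopE A : mxop A = opmx (fun i j (z : Cspace R) => A i j *: z).
Proof. by []. Qed.

Lemma scalar_opE M : scalar_op M = mxop (map_mx (real_complex R) M).
Proof.
apply/funext => x; apply: functional_extensionality_dep => i.
by rewrite /mxop; under eq_bigr do rewrite mxE.
Qed.

Lemma rnorm_Cspace (a : Cspace R) : rnorm a = rnorm (a : R[i]).
Proof.
apply/eqP; rewrite -(@eqrXn2 _ 2) ?rnorm_ge0//; apply/eqP.
apply: (@complexI R); rewrite -inner_rnorm Cspace_innerE rmorphXn/= -rnormE.
by rewrite normCK.
Qed.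

Lemma mxop_bounded A : bounded_op (mxop A).
Proof.
rewrite mxopE.
apply: opmx_bounded => i j.
apply: (@bounded_op_rnorm _ _ _ _ (rnorm (A i j))) => [a x y|x].
  by rewrite scalerDr !scalerA mulrC.
by rewrite rnormZ.
Qed.

Lemma scalar_op_bounded M : bounded_op (scalar_op M).
Proof. by rewrite scalar_opE; apply: mxop_bounded. Qed.

Lemma mxopM A B : mxop (A *m B) = mxop A \o mxop B.
Proof.
apply/funext => x; apply: functional_extensionality_dep => i.
rewrite /mxop /=.
under eq_bigr do rewrite mxE mulr_suml.
rewrite exchange_big; apply: eq_bigr => j _; rewrite mulr_sumr.
by apply: eq_bigr => k _; rewrite mulrA.
Qed.

Lemma inner_CnE x y : inner x y = \sum_i (x i : R[i]) * (y i : R[i])^*.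
Proof. by []. Qed.

Local Open Scope sesquilinear_scope.

Lemma inner_mxop A x y : inner (mxop A x) y = inner x (mxop (A ^t*) y).
Proof.
rewrite !inner_CnE /mxop; under eq_bigr do rewrite mulr_suml.
rewrite exchange_big; apply: eq_bigr => j _.
rewrite rmorph_sum mulr_sumr; apply: eq_bigr => i _.
by rewrite !mxE rmorphM/= conjCK mulrA [x j * _]mulrC.
Qed.

(** Diagonalize [A^* A = P^* diag(d) P] with [P] unitary.  Its eigenvalues
[d i] are squared norms of the columns of [A P^*], hence nonnegative, and
[P^* diag(sqrt d) P] is the root. *)
Lemma mxop_sqrt A : exists2 g, positive_op g & g \o g = mxop (A ^t* *m A).
Proof.
set B := _ *m _.
have Bh : B ^t* = B by rewrite /B trmx_mul map_mxM trmxCK.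
have /orthomx_spectralP : B \is normalmx by apply/normalmxP; rewrite Bh.
set P := spectralmx B; set d := spectral_diag B => BE.
have Pu : P \is unitarymx := spectral_unitarymx B.
have d0 i : 0 <= d 0 i.
  have : (P *m B *m P ^t*) i i = d 0 i.
    rewrite BE invmx_unitary// !mulmxA mulmxtVK// (unitarymxP Pu) mul1mx.
    by rewrite mxE eqxx.
  rewrite /B mulmxA -mulmxA -{1}(trmxCK P) -map_mxM -trmx_mul => <-.
  rewrite mxE; apply: sumr_ge0 => k _.
  by rewrite !mxE mulrC mul_conjC_ge0.
pose s := \row_i sqrtC (d 0 i).
exists (mxop (P ^t* *m diag_mx s *m P)); last first.
  rewrite -mxopM BE; congr mxop.
  have dE : diag_mx d = diag_mx s *m (P *m P ^t*) *m diag_mx s.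
    rewrite (unitarymxP Pu) mulmx1 mulmx_diag; congr diag_mx; apply/rowP => i.
    by rewrite !mxE -expr2 sqrtCK.
  by rewrite (invmx_unitary Pu) dE !mulmxA.
split; first exact: mxop_bounded.
move=> x; rewrite !mxopM /= inner_mxop trmxCK inner_CnE.
apply: sumr_ge0 => i _; set y := mxop P x.
have -> : mxop (diag_mx s) y i = s 0 i * (y i : R[i]).
  rewrite /mxop (bigD1 i)//= big1 => [|j ji].
    by rewrite mxE eqxx mulr1n addr0.
  by rewrite mxE eq_sym (negPf ji) mulr0n mul0r.
by rewrite -mulrA mulr_ge0 ?mul_conjC_ge0// mxE sqrtC_ge0.
Qed.

Lemma scalar_op_adj M x y :
  inner (scalar_op M x) y = inner x (scalar_op M^T y).
Proof.
rewrite !scalar_opE inner_mxop; congr (inner _ (mxop _ _)).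
by apply/matrixP => i j; rewrite !mxE conj_real.
Qed.

Lemma scalar_opM M N : scalar_op (M *m N) = scalar_op M \o scalar_op N.
Proof. by rewrite !scalar_opE map_mxM mxopM. Qed.

Lemma abs_op_sq M : abs_op (scalar_op M) \o abs_op (scalar_op M) =
  scalar_op (M^T *m M).
Proof.
rewrite /abs_op (adjointP (scalar_op_adj M)) -scalar_opM.
have [g pg gE] := mxop_sqrt (map_mx (real_complex R) M).
have E : scalar_op (M^T *m M) =
   mxop ((map_mx (real_complex R) M) ^t* *m map_mx (real_complex R) M).
  rewrite scalar_opE map_mxM; congr (mxop (_ *m _)).
  by apply/matrixP => i j; rewrite !mxE conj_real.
by rewrite E; exact: (sqrt_opK pg gE).
Qed.

(** Since [|M|] occurs only through [|M|^2 = M^* M], the form of the combination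
is a combination of squared norms. *)
Lemma inner_combination M N (a : R) x :
  inner (combination_op (scalar_op M) (scalar_op N) a x) x =
  (a * rnorm (scalar_op M x) ^+ 2 + (1 - a) * rnorm (scalar_op N x) ^+ 2)%:C%C.
Proof.
have -> : combination_op (scalar_op M) (scalar_op N) a x =
  a%:C%C *: (abs_op (scalar_op M) \o abs_op (scalar_op M)) x +
  (1 - a)%:C%C *: (abs_op (scalar_op N) \o abs_op (scalar_op N)) x by [].
rewrite !abs_op_sq !scalar_opM innerDl !innerZl /=.
rewrite ![inner (scalar_op _^T _) _]scalar_op_adj !trmxK !inner_rnorm.
by rewrite -!rmorphM -rmorphD.
Qed.

End mxop.

(** * Real quadratic forms and domination by nonnegative matrices *)

Section quadratic_form.
Variables (R : realType) (n : nat).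
Implicit Types (M N : 'M[R]_n) (v : 'I_n -> R).

(** [qform M v] is [<M v, v>] for the real vector [v], with values in [R]. *)
Definition qform M v : R := \sum_i \sum_j M i j * v j * v i.

Definition cvec v : Cn R n := fun i => (v i)%:C%C.

Lemma scalar_op_cvec M v :
  scalar_op M (cvec v) = cvec (fun i => \sum_j M i j * v j).
Proof.
rewrite scalar_opE; apply: functional_extensionality_dep => i.
rewrite /mxop /cvec rmorph_sum; apply: eq_bigr => j _.
by rewrite mxE rmorphM.
Qed.

Lemma rnorm_cvec v : rnorm (cvec v) ^+ 2 = \sum_i v i ^+ 2.
Proof.
rewrite rnorm_hsum; apply: eq_bigr => i _.
by rewrite rnorm_Cspace rnorm_real real_normK ?num_real.
Qed.

Lemma inner_cvec M v :
  inner (scalar_op M (cvec v)) (cvec v) = (qform M v)%:C%C.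
Proof.
rewrite scalar_op_cvec inner_CnE rmorph_sum; apply: eq_bigr => i _.
by rewrite /cvec conj_real -rmorphM mulr_suml.
Qed.

Lemma qform_tr M v : qform M^T v = qform M v.
Proof.
rewrite /qform exchange_big; apply: eq_bigr => i _; apply: eq_bigr => j _.
by rewrite mxE mulrAC.
Qed.

(** The transpose has the same form, so a form only sees the symmetric part of
its matrix. *)
Lemma qform_sym M v : qform (2^-1 *: (M + M^T)) v = qform M v.
Proof.
have -> : qform (2^-1 *: (M + M^T)) v = 2^-1 * (qform M v + qform M^T v).
  rewrite /qform -big_split mulr_sumr; apply: eq_bigr => i _.
  rewrite -big_split mulr_sumr; apply: eq_bigr => j _.
  by rewrite !mxE /=; ring.
by rewrite qform_tr; field.
Qed.

Lemma ler_qform M N v : (forall i, 0 <= v i) ->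
  (forall i j, M i j <= N i j) -> qform M v <= qform N v.
Proof.
move=> v0 MN; apply: ler_sum => i _; apply: ler_sum => j _.
by rewrite -!mulrA ler_wpM2r// mulr_ge0.
Qed.

Lemma qform_le M v :
  qform M v <= rnorm (scalar_op M (cvec v)) * rnorm (cvec v).
Proof.
have := cauchy_schwarz (scalar_op M (cvec v)) (cvec v).
by rewrite inner_cvec rnorm_real; apply: le_trans; apply: ler_norm.
Qed.

Lemma qform_le_numradius M v :
  qform M v <= numradius (scalar_op M) * rnorm (cvec v) ^+ 2.
Proof.
have := le_numradius (scalar_op_bounded M) (cvec v).
by rewrite inner_cvec rnorm_real; apply: le_trans; apply: ler_norm.
Qed.

End quadratic_form.

Section domination.
Variables (R : realType) (n : nat) (H : 'I_n -> hilbertType R[i]).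
Implicit Types (T : forall i j : 'I_n, H j -> H i) (M : 'M[R]_n) (x : hsum H).

Definition norms x : Cn R n := cvec (fun i => rnorm (x i)).

Lemma rnorm_norms x : rnorm (norms x) = rnorm x.
Proof.
apply/eqP; rewrite -(@eqrXn2 _ 2) ?rnorm_ge0//; apply/eqP.
by rewrite rnorm_cvec rnorm_hsum.
Qed.

Lemma rnorm_opmx_le T M x : (forall i j z, rnorm (T i j z) <= M i j * rnorm z) ->
  rnorm (opmx T x) <= rnorm (scalar_op M (norms x)).
Proof.
move=> TM; rewrite -(@ler_pXn2r _ 2) ?nnegrE ?rnorm_ge0//.
rewrite scalar_op_cvec rnorm_cvec rnorm_hsum; apply: ler_sum => i _.
have h : rnorm (opmx T x i) <= \sum_j M i j * rnorm (x j).
  by apply: le_trans (ler_rnorm_sum _) _; apply: ler_sum => j _.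
by rewrite ler_pXn2r ?nnegrE ?rnorm_ge0// (le_trans (rnorm_ge0 _) h).
Qed.

(** Only the blocks at the given [x] are assumed to be bounded, because the
diagonal ones will be bounded by their numerical radius, which controls
[<T i i y, z>] with constant one only for [y = z]. *)
Lemma inner_opmx_le T M x :
  (forall i j, rnorm (inner (T i j (x j)) (x i)) <=
     M i j * rnorm (x j) * rnorm (x i)) ->
  rnorm (inner (opmx T x) x) <= qform M (fun i => rnorm (x i)).
Proof.
move=> TM; rewrite hsum_innerE.
apply: le_trans (ler_rnorm_sum _) _; apply: ler_sum => i _.
have -> : inner (opmx T x i) (x i) = \sum_j inner (T i j (x j)) (x i).
  rewrite /opmx; elim/big_rec2 : _ => [|j a b _ <-]; first by rewrite inner0l.
  by rewrite innerDl.
by apply: le_trans (ler_rnorm_sum _) _; apply: ler_sum => j _.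
Qed.

End domination.

(** * The combination [a |M|^2 + (1 - a) |N|^2] *)

Section combination.
Variables (R : realType) (n : nat).
Implicit Types (M N : 'M[R]_n) (a b : R).

Lemma scalar_opD M N x : scalar_op (M + N) x = scalar_op M x + scalar_op N x.
Proof.
apply: functional_extensionality_dep => i.
rewrite -[RHS]/(scalar_op M x i + scalar_op N x i) /scalar_op /opmx -big_split.
by apply: eq_bigr => j _; rewrite mxE rmorphD scalerDl.
Qed.

Lemma scalar_opZ a M x : scalar_op (a *: M) x = a%:C%C *: scalar_op M x.
Proof.
apply: functional_extensionality_dep => i.
rewrite -[RHS]/(a%:C%C *: scalar_op M x i) /scalar_op /opmx scaler_sumr.
by apply: eq_bigr => j _; rewrite mxE rmorphM scalerA.
Qed.

Lemma opnorm_scalarD M N :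
  opnorm (scalar_op (M + N)) <= opnorm (scalar_op M) + opnorm (scalar_op N).
Proof.
apply: opnorm_le => [|x]; first by rewrite addr_ge0 ?opnorm_ge0.
rewrite scalar_opD mulrDl; apply: le_trans (ler_rnormD _ _) _.
by apply: lerD; apply: le_opnorm; apply: scalar_op_bounded.
Qed.

Lemma opnorm_scalarZ a M :
  opnorm (scalar_op (a *: M)) <= `|a| * opnorm (scalar_op M).
Proof.
apply: opnorm_le => [|x]; first by rewrite mulr_ge0 ?opnorm_ge0.
rewrite scalar_opZ rnormZ rnorm_real -mulrA ler_wpM2l//.
by apply: le_opnorm; apply: scalar_op_bounded.
Qed.

Lemma combination_opE M N a :
  combination_op (scalar_op M) (scalar_op N) a =
  scalar_op (a *: (M^T *m M) + (1 - a) *: (N^T *m N)).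
Proof.
apply/funext => x; rewrite scalar_opD !scalar_opZ.
by rewrite /combination_op !abs_op_sq.
Qed.

Lemma ler_dist (u v w e : R) : u <= v + w -> v <= u + w -> w <= e ->
  `|v - u| <= e.
Proof. by move=> ? ? ?; rewrite ler_norml; lra. Qed.

(** The operators at [a] and [b] differ by [(a - b) (M^* M - N^* N)], so the norm
is Lipschitz in [a]. *)
Lemma opnorm_combination_continuous M N :
  continuous (fun a => opnorm (combination_op (scalar_op M) (scalar_op N) a)).
Proof.
set g := fun a => _.
pose K := opnorm (scalar_op (M^T *m M - N^T *m N)).
have gK a b : g a <= g b + `|a - b| * K.
  rewrite /g !combination_opE.
  have -> : a *: (M^T *m M) + (1 - a) *: (N^T *m N) =
      (b *: (M^T *m M) + (1 - b) *: (N^T *m N)) +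
      (a - b) *: (M^T *m M - N^T *m N).
    by apply/matrixP => i j; rewrite !mxE; ring.
  apply: le_trans (opnorm_scalarD _ _) _.
  by rewrite lerD2l opnorm_scalarZ.
have K0 : 0 <= K by apply: opnorm_ge0.
move=> b; apply/cvgrPdist_le => e e0.
have eK : 0 < e / (K + 1) by rewrite divr_gt0// ltr_wpDl.
near=> a.
have ab : `|b - a| <= e / (K + 1) by near: a; apply: cvgr_dist_le => //; exact: cvg_id.
have {}ab : `|b - a| * K <= e.
  apply: le_trans (ler_wpM2r K0 ab) _.
  by rewrite -mulrA ger_pMr// mulrC ler_pdivrMr ?ltr_wpDl// mul1r lerDl.
have gab := gK a b; rewrite distrC in gab.
exact: ler_dist gab (gK b a) ab.
Unshelve. all: by end_near. Qed.

Lemma le_combination M N a x :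
  a * rnorm (scalar_op M x) ^+ 2 + (1 - a) * rnorm (scalar_op N x) ^+ 2 <=
  opnorm (combination_op (scalar_op M) (scalar_op N) a) * rnorm x ^+ 2.
Proof.
have bc : bounded_op (combination_op (scalar_op M) (scalar_op N) a).
  by rewrite combination_opE; apply: scalar_op_bounded.
apply: le_trans (le_trans (le_numradius bc x) _).
  by rewrite inner_combination rnorm_real ler_norm.
by rewrite ler_wpM2r ?exprn_ge0 ?rnorm_ge0// numradius_le_opnorm.
Qed.

(** [||M^T x||^2 = <M M^T x, x> <= ||M|| ||M^T x|| ||x||]. *)
Lemma opnorm_scalar_tr M : opnorm (scalar_op M^T) <= opnorm (scalar_op M).
Proof.
apply: opnorm_le (opnorm_ge0 _) _ => x; set y := scalar_op M^T x.
have [->|y0] := eqVneq (rnorm y) 0.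
  by rewrite mulr_ge0 ?opnorm_ge0 ?rnorm_ge0.
have yp : 0 < rnorm y by rewrite lt_def y0 rnorm_ge0.
rewrite -(ler_pM2r yp) -expr2.
have -> : rnorm y ^+ 2 = rnorm (inner (scalar_op M y) x).
  by rewrite scalar_op_adj inner_rnorm rnorm_real ger0_norm ?exprn_ge0 ?rnorm_ge0.
apply: le_trans (cauchy_schwarz _ _) _; rewrite mulrAC ler_wpM2r ?rnorm_ge0//.
by apply: le_opnorm; apply: scalar_op_bounded.
Qed.

Lemma opnorm_gram_le M : opnorm (scalar_op (M^T *m M)) <= opnorm (scalar_op M) ^+ 2.
Proof.
apply: opnorm_le => [|x]; first by rewrite exprn_ge0 ?opnorm_ge0.
rewrite scalar_opM /= expr2 -mulrA.
apply: le_trans (le_opnorm (scalar_op_bounded _) _) _.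
apply: ler_pM; rewrite ?opnorm_ge0 ?rnorm_ge0 ?opnorm_scalar_tr//.
by apply: le_opnorm; apply: scalar_op_bounded.
Qed.

Lemma combination0_le M N :
  Num.sqrt (opnorm (combination_op (scalar_op M) (scalar_op N) 0)) <=
  opnorm (scalar_op N).
Proof.
rewrite combination_opE scale0r add0r subr0 scale1r.
rewrite -[leRHS]ger0_norm ?opnorm_ge0// -sqrtr_sqr.
by apply: ler_wsqrtr; apply: opnorm_gram_le.
Qed.

Lemma combination1_le M N :
  Num.sqrt (opnorm (combination_op (scalar_op M) (scalar_op N) 1)) <=
  opnorm (scalar_op M).
Proof.
rewrite combination_opE subrr scale0r addr0 scale1r.
rewrite -[leRHS]ger0_norm ?opnorm_ge0// -sqrtr_sqr.
by apply: ler_wsqrtr; apply: opnorm_gram_le.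
Qed.

Lemma sqrt_combination_continuous M N :
  continuous (fun a =>
    Num.sqrt (opnorm (combination_op (scalar_op M) (scalar_op N) a))).
Proof.
move=> a; apply: continuous_comp; last exact: sqrt_continuous.
exact: opnorm_combination_continuous.
Qed.

Lemma sqrt_opnorm_le_combination M N a : 0 <= a <= 1 ->
  Num.sqrt (1 - a) * opnorm (scalar_op N) <=
  Num.sqrt (opnorm (combination_op (scalar_op M) (scalar_op N) a)).
Proof.
move=> /andP[a0 a1]; have a1' : 0 <= 1 - a by rewrite subr_ge0.
set s := Num.sqrt (1 - a).
have [s0|s0] := eqVneq s 0; first by rewrite s0 mul0r sqrtr_ge0.
have sp : 0 < s by rewrite lt_def s0 sqrtr_ge0.
rewrite mulrC -ler_pdivlMr//; apply: opnorm_le => [|x].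
  by rewrite divr_ge0 ?sqrtr_ge0.
rewrite mulrAC ler_pdivlMr//.
rewrite -(@ler_pXn2r _ 2) ?nnegrE ?mulr_ge0 ?sqrtr_ge0 ?rnorm_ge0//.
rewrite !exprMn !sqr_sqrtr ?opnorm_ge0//.
apply: le_trans (le_combination M N a x).
by rewrite mulrC lerDr mulr_ge0 ?exprn_ge0 ?rnorm_ge0.
Qed.

(** The mean of the squares of the two assumed estimates, with weights [a] and
[1 - a], is the form of the combination at [norms x]. *)
Lemma numradius_le_combination (H : 'I_n -> hilbertType R[i])
    (T : forall i j : 'I_n, H j -> H i) M N a : 0 <= a <= 1 ->
  (forall x, rnorm (inner (opmx T x) x) <=
     rnorm (scalar_op M (norms x)) * rnorm x) ->
  (forall x, rnorm (inner (opmx T x) x) <=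
     rnorm (scalar_op N (norms x)) * rnorm x) ->
  numradius (opmx T) <=
  Num.sqrt (opnorm (combination_op (scalar_op M) (scalar_op N) a)).
Proof.
move=> /andP[a0 a1] TM TN; have a1' : 0 <= 1 - a by rewrite subr_ge0.
apply: numradius_le => [|x]; first exact: sqrtr_ge0.
set c := rnorm (inner _ _); pose r2 := rnorm x ^+ 2.
have r0 : 0 <= r2 := sqr_ge0 _.
have sq (s : R) : c <= s * rnorm x -> c ^+ 2 <= s ^+ 2 * r2.
  move=> h; rewrite -exprMn ler_pXn2r// nnegrE; first exact: rnorm_ge0.
  exact: le_trans (rnorm_ge0 _) h.
rewrite -(@ler_pXn2r _ 2) ?nnegrE ?mulr_ge0 ?sqrtr_ge0 ?rnorm_ge0//.
rewrite exprMn sqr_sqrtr ?opnorm_ge0// [_ ^+ 2 ^+ 2]expr2 mulrA.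
have := le_combination M N a (norms x); rewrite rnorm_norms => hc.
apply: le_trans (ler_wpM2r r0 hc).
have := ler_wpM2l a0 (sq _ (TM x)); have := ler_wpM2l a1' (sq _ (TN x)).
lra.
Qed.

End combination.

(** * The corollary *)

Section corollary.
Variables (R : realType) (n : nat) (H : 'I_n -> hilbertType R[i]).
Implicit Types (T : forall i j : 'I_n, H j -> H i) (x : hsum H).

Lemma R_mxE T : R_mx T = 2^-1 *: (tilde_mx T + (tilde_mx T)^T).
Proof.
apply/matrixP => i j; rewrite !mxE eq_sym.
by case: eqVneq => [->|_]; [field|rewrite mulrC].
Qed.

Lemma R_mx_tr T : (R_mx T)^T = R_mx T.
Proof. by rewrite R_mxE linearZ linearD /= trmxK addrC. Qed.

Lemma inner_opmx_le_tilde T x : (forall i j, bounded_op (T i j)) ->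
  rnorm (inner (opmx T x) x) <= qform (tilde_mx T) (fun i => rnorm (x i)).
Proof.
move=> bT; apply: inner_opmx_le => i j.
rewrite mxE; case: eqVneq => [->|_].
  by rewrite -mulrA -expr2 le_numradius.
apply: le_trans (cauchy_schwarz _ _) _.
by rewrite ler_wpM2r ?rnorm_ge0// le_opnorm.
Qed.

Lemma inner_opmx_le_R T x : (forall i j, bounded_op (T i j)) ->
  rnorm (inner (opmx T x) x) <= rnorm (scalar_op (R_mx T) (norms x)) * rnorm x.
Proof.
move=> bT; apply: le_trans (inner_opmx_le_tilde x bT) _.
by rewrite -qform_sym -R_mxE -(rnorm_norms x) qform_le.
Qed.

Lemma inner_opmx_le_S T x : (forall i j, bounded_op (T i j)) ->
  rnorm (inner (opmx T x) x) <= rnorm (scalar_op (S_mx T) (norms x)) * rnorm x.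
Proof.
move=> bT; apply: le_trans (inner_opmx_le_tilde x bT) _.
rewrite -(rnorm_norms x); apply: le_trans (qform_le _ _).
apply: ler_qform => [i|i j]; first exact: rnorm_ge0.
by rewrite !mxE; case: eqVneq => [->|//]; apply: numradius_le_opnorm.
Qed.

Lemma opnorm_opmx_le T : (forall i j, bounded_op (T i j)) ->
  opnorm (opmx T) <= opnorm (scalar_op (S_mx T)).
Proof.
move=> bT; apply: opnorm_le (opnorm_ge0 _) _ => x.
have h : rnorm (opmx T x) <= rnorm (scalar_op (S_mx T) (norms x)).
  by apply: rnorm_opmx_le => i j z; rewrite mxE le_opnorm.
apply: le_trans h _; rewrite -(rnorm_norms x).
by apply: le_opnorm; apply: scalar_op_bounded.
Qed.

(** [R] is self-adjoint, so its norm is its numerical radius.  Its entries are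
nonnegative, so its form at [z] is at most the form at [|z|], where it agrees
with the form of [tilde_mx T]. *)
Lemma opnorm_R_le T :
  opnorm (scalar_op (R_mx T)) <= numradius (scalar_op (tilde_mx T)).
Proof.
apply: (@le_trans _ _ (numradius (scalar_op (R_mx T)))).
  apply: opnorm_le_numradius; first exact: scalar_op_bounded.
  by move=> x y; rewrite scalar_op_adj R_mx_tr.
apply: numradius_le; first exact: numradius_ge0.
move=> z; apply: (@le_trans _ _ (qform (R_mx T) (fun i => rnorm (z i)))).
  apply: inner_opmx_le => i j.
  apply: le_trans (cauchy_schwarz _ _) _.
  rewrite ler_wpM2r ?rnorm_ge0// rnormZ rnorm_real ger0_norm// mxE.
  by case: ifP => _; rewrite ?numradius_ge0// divr_ge0// addr_ge0 ?opnorm_ge0.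
rewrite R_mxE qform_sym -(rnorm_norms z).
exact: qform_le_numradius.
Qed.

End corollary.

Lemma min_between (R : realType) (f : R -> R) (l u : R) : continuous f ->
  (forall a, 0 <= a <= 1 -> l <= f a) -> (exists2 a, 0 <= a <= 1 & f a <= u) ->
  exists m,
    [/\ is_min [set f a | a in [set a : R | 0 <= a <= 1]] m, l <= m & m <= u].
Proof.
move=> cf lf [a a01 fau].
have [c] := @EVT_min R f 0 1 ler01 (continuous_subspaceT cf).
rewrite in_itv /= => c01 cmin; exists (f c); split.
- split; first by exists c.
  by move=> _ [t /= t01 <-]; apply: cmin; rewrite in_itv.
- exact: lf.
- by apply: le_trans fau; apply: cmin; rewrite in_itv.
Qed.

Theorem corollary2p9 (R : realType) (n : nat) (n_gt0 : (0 < n)%N)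
    (H : 'I_n -> hilbertType R[i]) (T : forall i j : 'I_n, H j -> H i)
    (T_bounded : forall i j : 'I_n, bounded_op (T i j)) :
  let Rop := scalar_op (R_mx T) in
  let Sop := scalar_op (S_mx T) in
  let f (alpha : R) := Num.sqrt (opnorm (combination_op Rop Sop alpha)) in
  (exists m : R,
    [/\ is_min [set f alpha | alpha in [set alpha : R | 0 <= alpha <= 1]] m,
        numradius (opmx T) <= m
      & m <= numradius (scalar_op (tilde_mx T))]) /\
  (exists m : R,
    [/\ is_min [set 1 / Num.max (1 / 2) (Num.sqrt (1 - alpha)) * f alpha
               | alpha in [set alpha : R | 0 <= alpha <= 1]] m,
        opnorm (opmx T) <= m
      & m <= opnorm Sop]).
Proof.
move=> Rop Sop f.
have cf : continuous f by apply: sqrt_combination_continuous.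
have wf a : 0 <= a <= 1 -> numradius (opmx T) <= f a.
  move=> a01; apply: numradius_le_combination => // x.
    exact: inner_opmx_le_R.
  exact: inner_opmx_le_S.
split.
  apply: min_between => //; exists 1; first by rewrite ler01 lexx.
  exact: le_trans (combination1_le _ _) (opnorm_R_le T).
have max_gt0 (a : R) : 0 < Num.max (1 / 2) (Num.sqrt (1 - a)).
  by rewrite lt_max divr_gt0.
apply: min_between.
- move=> a; apply: cvgM; last exact: cf.
  apply: cvgM; first exact: cvg_cst.
  apply: cvgV; first by rewrite gt_eqF.
  have cs : {for a, continuous (fun b : R => Num.sqrt (1 - b))}.
    apply: continuous_comp; last exact: sqrt_continuous.
    by apply: cvgB; [exact: cvg_cst|exact: cvg_id].
  have := @continuous_max _ _ (fun=> 1 / 2 : R) _ a (@cvg_cst _ _ _ _ _) cs.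
  exact.
- move=> a a01; rewrite mul1r mulrC ler_pdivlMr//.
  rewrite maxr_pMr ?opnorm_ge0// ge_max; apply/andP; split.
    have := opnorm_le_2numradius (opmx_bounded T_bounded); have := wf a a01; lra.
  apply: le_trans (sqrt_opnorm_le_combination (R_mx T) (S_mx T) a01).
  by rewrite mulrC ler_wpM2l ?sqrtr_ge0// opnorm_opmx_le.
- exists 0; first by rewrite lexx ler01.
  rewrite subr0 sqrtr1 max_r ?invr1 ?divr1 ?mul1r; last by lra.
  exact: combination0_le.
Qed.
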